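(* Let $G$ be a $3$-connected graph in $\mathcal{G}_2$ that has a $5$-cycle. If every $3$-cutset of $G$ is a stable set, then $G$ contains two distinct $5$-cycles sharing at least one edge.
   Context: All graphs are finite and simple. A hole is an induced cycle of length at least $4$; an odd hole is a hole of odd length. $\mathcal{G}_2$ is the family of graphs of girth exactly $5$ having no odd holes of length at least $7$. A $3$-cutset is a set of $3$ vertices whose removal disconnects the graph; a set is stable if it induces no edges. *)

(* Defs.v *)
From mathcomp Require Import all_boot.

Set Implicit Arguments.
Unset Strict Implicit.
Unset Printing Implicit Defensive.

(** A finite simple graph is a symmetric irreflexive relation [e : rel T] on a
    [T : finType]. *)

Section Graphs.
Variable (T : finType) (e : rel T).

Definition is_simple_graph : Prop := symmetric e /\ irreflexive e.

(** A cycle is given by a cyclic listing [c] of its vertices.  Rotating or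
    reversing [c] gives the same cycle; the subgraph itself is identified by
    [cycle_edges c]. *)
Definition is_cycle (c : seq T) : Prop :=
  [/\ cycle e c, uniq c & 3 <= size c].

Definition cycle_edges (c : seq T) : {set {set T}} :=
  [set [set x; next c x] | x in c].

Definition is_induced_cycle (c : seq T) : Prop :=
  is_cycle c /\
  (forall x y, x \in c -> y \in c -> e x y -> [set x; y] \in cycle_edges c).

Definition is_hole (c : seq T) : Prop := is_induced_cycle c /\ 4 <= size c.

Definition is_odd_hole (c : seq T) : Prop := is_hole c /\ odd (size c).

Definition has_girth (g : nat) : Prop :=
  (exists c, is_cycle c /\ size c = g) /\
  (forall c, is_cycle c -> g <= size c).

Definition in_G2 : Prop :=
  has_girth 5 /\ ~ (exists c, is_odd_hole c /\ 7 <= size c).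

(** Adjacency in G - S; its vertices are the elements of [~: S]. *)
Definition del_rel (S : {set T}) : rel T :=
  [rel x y | [&& x \notin S, y \notin S & e x y]].

(** G - S is disconnected: two of its vertices are joined by no path. *)
Definition disconnects (S : {set T}) : Prop :=
  exists x y, [/\ x \notin S, y \notin S & ~~ connect (del_rel S) x y].

Definition k_connected (k : nat) : Prop :=
  k < #|T| /\ (forall S : {set T}, #|S| < k -> ~ disconnects S).

Definition is_cutset (k : nat) (S : {set T}) : Prop :=
  #|S| = k /\ disconnects S.

Definition stable (S : {set T}) : Prop :=
  forall x y, x \in S -> y \in S -> ~~ e x y.

End Graphs.

(* Main.v *)
(* Suppose that the 5-cycles are pairwise edge-disjoint and let C be one of
   them.  A vertex outside C has at most one neighbour on C, its colour.  Closing
   an induced walk outside C with an arc of C gives a hole, which must be even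
   as soon as the arc has an edge.  These parities exclude a walk outside C that
   joins a neighbour of v_{i-1} to a neighbour of v_{i+1} and avoids the
   neighbours of v_i.  Consequently no component of G - C sees four vertices of C,
   since the shortest prefix of a walk seeing four of them sees exactly four and
   misses one vertex but not its two neighbours on C.  A component missing two
   vertices of C, on the other hand, is cut off by the other three, and any three
   vertices of a 5-cycle contain an edge. *)

Require Import Defs.
From mathcomp Require Import all_boot zify.
From Stdlib Require Import Classical.

Set Implicit Arguments.
Unset Strict Implicit.
Unset Printing Implicit Defensive.

Section Graph.
Variables (T : finType) (e : rel T).

(** * Cycles listed by a function on indices *)

Lemma next_mkseq (u : nat -> T) (n i : nat) :
  uniq (mkseq u n) -> i < n ->
  next (mkseq u n) (u i) = if i.+1 < n then u i.+1 else u 0.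
Proof.
case: n => // n uniq_u lt_i.
have lt_i' : i < size (mkseq u n.+1) by rewrite size_mkseq.
have idx : index (u i) (mkseq u n.+1) = i.
  by have := index_uniq (u 0) lt_i' uniq_u; rewrite nth_mkseq.
have mem_i : u i \in mkseq u n.+1 by rewrite -index_mem idx.
rewrite next_nth mem_i idx /= ltnS.
case: ltnP => [lt_in | le_n]; last by rewrite nth_default // size_map size_iota.
by rewrite (nth_map 0) ?size_iota // nth_iota.
Qed.

(** Only pairs [i < j] are constrained, which leaves index arithmetic for [lia]; the disjunct with
    [i == 0] is the closing edge. *)
Lemma induced_cycle_mkseq (u : nat -> T) (n : nat) :
  symmetric e -> irreflexive e -> 3 <= n ->
  (forall i j, i < j < n -> u i != u j) ->
  (forall i j, i < j < n -> e (u i) (u j) = (j == i.+1) || (i == 0) && (j == n.-1)) ->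
  is_induced_cycle e (mkseq u n).
Proof.
move=> esym eirr n3 u_inj eu.
have uniq_u : uniq (mkseq u n).
  apply/(uniqP (u 0)) => i j; rewrite !inE size_mkseq => lt_i lt_j.
  rewrite !nth_mkseq // => /eqP eq_u; case: (ltngtP i j) => // lt_ij.
    by move: eq_u; rewrite (negPf (u_inj i j _)) // lt_ij.
  by move: eq_u; rewrite eq_sym (negPf (u_inj j i _)) // lt_ij.
have mem_u i : i < n -> u i \in mkseq u n.
  by move=> lt_i; apply/mapP; exists i; rewrite // mem_iota.
have edge i j : i < j < n -> e (u i) (u j) -> [set u i; u j] \in cycle_edges (mkseq u n).
  move=> lt_ij; rewrite eu // => /orP[/eqP eq_j | /andP[/eqP-> /eqP->]].
    apply/imsetP; exists (u i); first by rewrite mem_u; lia.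
    by rewrite next_mkseq ?ifT -?eq_j //; lia.
  apply/imsetP; exists (u n.-1); first by rewrite mem_u; lia.
  by rewrite next_mkseq ?ifF 1?setUC //; lia.
split; first split; rewrite ?size_mkseq //.
- apply: cycle_from_next => // x /mapP[i]; rewrite mem_iota => /= lt_i ->.
  rewrite next_mkseq //; case: ifP => ltn; first by rewrite eu; lia.
  by rewrite esym eu; lia.
- move=> x y /mapP[i]; rewrite mem_iota => /= lt_i -> /mapP[j].
  rewrite mem_iota => /= lt_j -> exy.
  case: (ltngtP i j) exy => [lt_ij exy|lt_ji exy|->]; last by rewrite eirr.
    by apply: edge; rewrite // lt_ij.
  by rewrite setUC; apply: edge; rewrite ?lt_ji // esym.
Qed.

(** * Induced walks of least length *)

Definition induced_walk (w : nat -> T) (n : nat) : Prop :=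
  (forall i j, i < j <= n -> w i != w j) /\
  (forall i j, i < j <= n -> e (w i) (w j) = (j == i.+1)).

Definition induced_rel (A : pred T) : rel T := [rel x y | [&& A x, A y & e x y]].

(** Take a walk of least length from [P] to [Q] inside [A]. A repetition or a chord would give a
    shortcut, and a second vertex in [P] or in [Q] would allow truncation. *)
Lemma exists_induced_walk (A P Q : pred T) (x y : T) :
  symmetric e -> irreflexive e -> A x -> P x -> Q y ->
  connect (induced_rel A) x y ->
  exists (w : nat -> T) (n : nat),
    [/\ induced_walk w n,
        forall k, k <= n -> A (w k),
        forall k, k <= n -> P (w k) = (k == 0)
      & forall k, k <= n -> Q (w k) = (k == n)].
Proof.
move=> esym eirr Ax Px Qy /connectP[p path_p def_y].
pose walk (w : nat -> T) n := [/\ forall k, k <= n -> A (w k), P (w 0), Q (w n)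
  & forall k, k < n -> e (w k) (w k.+1)].
have [w [n walk_w]] : exists w n, walk w n.
  exists (nth x (x :: p)), (size p); split=> //; last 1 first.
  - by move=> k /(pathP x path_p k) /and3P[].
  - case=> // k lt_k; by have /and3P[] := pathP x path_p k lt_k.
  - by rewrite nth_last /= -def_y.
elim/ltn_ind: n w walk_w => n IHn w walk_w.
have [[m [lt_mn [w' walk_w']]] | no_short] :=
    classic (exists m, m < n /\ exists w', walk w' m); first exact: IHn walk_w'.
have {IHn} minw m w' : m < n -> ~ walk w' m.
  by move=> lt_mn walk_w'; apply: no_short; exists m; split=> //; exists w'.
case: walk_w => Aw Pw Qw ew.
(* [skip i d] cuts out the [d] vertices that follow [w i]. *)
pose skip i d k := if k <= i then w k else w (k + d).
have walk_skip i d : i + d < n -> e (w i) (w (i + d).+1) -> walk (skip i d) (n - d).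
  move=> lt_n e_i; split; rewrite /skip //.
  - by move=> k le_k; case: ifP => le_i; apply: Aw; lia.
  - by rewrite ifF; [rewrite subnK //; lia | lia].
  - move=> k lt_k; case: (ltngtP k i) => [lt_ki | lt_ik | ->].
    + by apply: ew; lia.
    + by rewrite addSn; apply: ew; lia.
    + by rewrite addSn.
exists w, n; split=> //.
- split=> i j /andP[lt_ij le_jn].
  (* A repetition of the last vertex has no successor to skip to; there the prefix ending at [i]
     already reaches [Q]. *)
  + apply/eqP=> eq_w; have [eq_n | lt_n] := eqVneq j n.
      apply: (minw i w); first by lia.
      split=> // [k le_k||k lt_k]; last by apply: ew; lia.
        by apply: Aw; lia.
      by rewrite eq_w eq_n.
    apply: (minw (n - (j - i)) (skip i (j - i))); first by lia.
    apply: walk_skip; first by lia.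
    rewrite eq_w; have -> : i + (j - i) = j by lia.
    by apply: ew; lia.
  + apply/idP/eqP => [e_ij | ->]; last by apply: ew; lia.
    apply/eqP/negPn/negP => neq_j.
    apply: (minw (n - (j - i).-1) (skip i (j - i).-1)); first by lia.
    apply: walk_skip; first by lia.
    by have -> : (i + (j - i).-1).+1 = j by lia.
- move=> k le_k; apply/idP/eqP => [Pk | -> //].
  apply/eqP/negPn/negP => k_neq0.
  apply: (minw (n - k) (fun j => w (j + k))); first by lia.
  split=> // [j le_j | | j lt_j]; [apply: Aw; lia | by rewrite subnK | ].
  by rewrite addSn; apply: ew; lia.
- move=> k le_k; apply/idP/eqP => [Qk | -> //].
  apply/eqP/negPn/negP => k_neqn.
  apply: (minw k w); first by lia.
  by split=> // [j le_j | j lt_j]; [apply: Aw; lia | apply: ew; lia].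
Qed.

(** * Pentagons in girth at least 5 *)

Section Girth5.
Hypotheses (esym : symmetric e) (eirr : irreflexive e).
Hypothesis girth5 : forall c, is_cycle e c -> 5 <= size c.

Lemma triangle_free x y z : e x y -> e y z -> e x z = false.
Proof.
move=> exy eyz; apply/negP => exz.
suff /girth5 : is_cycle e [:: x; y; z] by [].
have [/eqP nxy /eqP nyz /eqP nxz] : [/\ x <> y, y <> z & x <> z].
  by split=> eq_v; subst; rewrite eirr in exy eyz exz.
by split; rewrite //= ?exy ?eyz 1?esym ?exz // !inE negb_or nxy nxz nyz.
Qed.

Lemma square_free x y z t :
  x != z -> y != t -> e x y -> e y z -> e z t -> e t x = false.
Proof.
move=> nxz nyt exy eyz ezt; apply/negP => etx.
suff /girth5 : is_cycle e [:: x; y; z; t] by [].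
have [/eqP nxy /eqP nyz /eqP nzt /eqP ntx] : [/\ x <> y, y <> z, z <> t & t <> x].
  by split=> eq_v; subst; rewrite eirr in exy eyz ezt etx.
split; rewrite //= ?exy ?eyz ?ezt ?etx // !inE !negb_or.
by rewrite nxy nxz nyz nyt nzt eq_sym ntx.
Qed.

Lemma pentagon_induced c : is_cycle e c -> size c = 5 -> is_induced_cycle e c.
Proof.
case: c => [|a [|b [|c [|d [|f [|]]]]]] // cyc _.
have [/and5P[eab ebc ecd edf /andP[efa _]] uq _] := cyc.
have eac := triangle_free eab ebc. have ebd := triangle_free ebc ecd.
have ecf := triangle_free ecd edf. have eda := triangle_free edf efa.
have efb := triangle_free efa eab.
pose u := nth a [:: a; b; c; d; f].
have -> : [:: a; b; c; d; f] = mkseq u 5 by [].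
rewrite esym in eda; rewrite esym in efb; rewrite esym in efa.
apply: induced_cycle_mkseq => // [i j lt_ij | i j].
  by rewrite nth_uniq //=; clear -lt_ij; lia.
case: i => [|[|[|[|[|i]]]]]; case: j => [|[|[|[|[|j]]]]] //=; rewrite ?ltnS ?andbF //=.
Qed.

Lemma mem_eq_cycle_edges (c c' : seq T) x :
  cycle_edges c = cycle_edges c' -> x \in c -> x \in c'.
Proof.
move=> eq_cE xc; have : [set x; next c x] \in cycle_edges c'.
  by rewrite -eq_cE; apply/imsetP; exists x.
case/imsetP=> y yc' eq_E; have : x \in [set y; next c' y] by rewrite -eq_E set21.
by case/set2P=> ->; rewrite ?mem_next.
Qed.

Lemma pentagon_rot c u : is_cycle e c -> size c = 5 -> u \in c ->
  exists v1 v2 v3 v4, is_cycle e [:: u; v1; v2; v3; v4] /\ c =i [:: u; v1; v2; v3; v4].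
Proof.
case=> cyc_c uniq_c _ size_c /rot_to[i c' def_c].
rewrite -(rot_cycle i) def_c in cyc_c; rewrite -(rot_uniq i) def_c in uniq_c.
rewrite -(size_rot i) def_c in size_c.
have mem_c z : (z \in c) = (z \in u :: c') by rewrite -def_c mem_rot.
case: c' size_c cyc_c uniq_c mem_c {def_c} => [|v1 [|v2 [|v3 [|v4 []]]]] // _ *.
by exists v1, v2, v3, v4.
Qed.

Lemma pentagon_diameter c x y : is_cycle e c -> size c = 5 ->
  x \in c -> y \in c -> x != y -> e x y \/ exists2 z, z \in c & e x z && e z y.
Proof.
move=> cyc_c size_c xc.
have [a [b [c' [d [cyc_c' mem_c]]]]] := pentagon_rot cyc_c size_c xc.
have [/= /and5P[exa eab ebc ecd /andP[edx _]] _ _] := cyc_c'.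
rewrite mem_c inE (eq_sym y x) => /orP[/eqP-> /eqP // | yc' _].
move: (yc'); rewrite !inE => /or4P[] /eqP->.
- by left.
- by right; exists a; rewrite ?exa // mem_c !inE eqxx ?orbT.
- by right; exists d; rewrite 1?esym ?edx 1?esym ?ecd // mem_c !inE eqxx ?orbT.
- by left; rewrite esym.
Qed.

(** Two neighbours of [x] on the pentagon are at distance 1 or 2 along it, so they would close a
    triangle or a square. *)
Lemma one_neighbour_on_pentagon c x u v : is_cycle e c -> size c = 5 ->
  x \notin c -> u \in c -> v \in c -> u != v -> e x u -> e x v = false.
Proof.
move=> cyc_c size_c xc uc vc nuv exu.
have [euv | [z zc /andP[euz ezv]]] := pentagon_diameter cyc_c size_c uc vc nuv.
  exact: triangle_free exu euv.
rewrite esym; apply: square_free exu euz ezv => //.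
by apply: contraNneq xc => ->.
Qed.

(** The cycle runs along the walk from [w s] to [w t] and returns through [q]. Both disjuncts of the
    crossing condition concern the same vertex when [q] is a singleton. *)
Lemma hole_through_walk (w : nat -> T) n s t (x0 : T) (q : seq T) :
  induced_walk w n -> s < t <= n -> 0 < size q -> uniq q ->
  (forall i j, i < j < size q -> e (nth x0 q i) (nth x0 q j) = (j == i.+1)) ->
  (forall k, k <= n -> w k \notin q) ->
  (forall k j, s <= k <= t -> j < size q ->
     e (w k) (nth x0 q j) = (k == t) && (j == 0) || (k == s) && (j == (size q).-1)) ->
  exists c, [/\ is_induced_cycle e c, size c = t - s + size q + 1,
                {subset q <= c} & w s \in c].
Proof.
move=> [w_inj ew] /andP[lt_st le_tn] q_gt0 uniq_q eq w_q cross.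
(* The walk occupies positions [0] to [t - s], so [q] starts at position [(t - s).+1]. *)
pose u k := if k <= t - s then w (s + k) else nth x0 q (k - (t - s).+1).
exists (mkseq u (t - s + size q + 1)); split; last 1 first.
- by apply/mapP; exists 0; rewrite ?mem_iota ?addn1 // /u /= addn0.
- apply: induced_cycle_mkseq => //; first by lia.
  + move=> i j lt_ij; rewrite /u; case: (leqP i) => le_i; case: (leqP j) => le_j.
    * by apply: w_inj; lia.
    * have le_n : s + i <= n by lia.
      have lt_q : j - (t - s).+1 < size q by lia.
      by apply/eqP=> eq_w; have /negP[] := w_q (s + i) le_n; rewrite eq_w mem_nth.
    * by lia.
    * have lt_i : i - (t - s).+1 < size q by lia.
      have lt_j : j - (t - s).+1 < size q by lia.
      by rewrite nth_uniq //; lia.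
  + move=> i j lt_ij; rewrite /u; case: (leqP i) => le_i; case: (leqP j) => le_j.
    * by rewrite ew; lia.
    * by rewrite cross //; lia.
    * by lia.
    * by rewrite eq; lia.
- by rewrite size_mkseq.
- move=> x xq; have lt_x : index x q < size q by rewrite index_mem.
  apply/mapP; exists ((t - s).+1 + index x q); first by rewrite mem_iota; lia.
  by rewrite /u ifF ?addKn ?nth_index //; lia.
Qed.

Section NoSharedEdge.
Hypothesis no_odd_hole : ~ exists c, is_odd_hole e c /\ 7 <= size c.
Hypothesis no_shared_edge : forall c1 c2 E,
  is_cycle e c1 -> size c1 = 5 -> is_cycle e c2 -> size c2 = 5 ->
  E \in cycle_edges c1 -> E \in cycle_edges c2 -> cycle_edges c1 = cycle_edges c2.

Lemma induced_cycle_even_or_5 c :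
  is_induced_cycle e c -> 5 <= size c /\ (odd (size c) -> size c = 5).
Proof.
move=> ind_c; have [cyc_c _] := ind_c; have size_c := girth5 cyc_c.
split=> // odd_c; apply/eqP/negPn/negP => size_neq5; apply: no_odd_hole.
exists c; split; first by split=> //; split=> //; lia.
by lia.
Qed.

(** * Closing a walk with an arc of one pentagon *)

Section OnePentagon.
Variables (c : seq T) (x0 : T).
Hypotheses (cyc_c : is_cycle e c) (size_c : size c = 5).
Let v i := nth x0 c i.

(** Adjacency on indices in computable form, so that [isT] certifies concrete arcs. *)
Definition adj5 i j := (j == i.+1 %% 5) || (i == j.+1 %% 5).

Lemma adj5E i j : i < 5 -> j < 5 -> e (v i) (v j) = adj5 i j.
Proof.
rewrite /v; case: c cyc_c size_c => [|a [|b [|c' [|d [|f []]]]]] // cyc _.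
have [/and5P[eab ebc ecd edf /andP[efa _]] _ _] := cyc.
have eac := triangle_free eab ebc. have ebd := triangle_free ebc ecd.
have ecf := triangle_free ecd edf. have eda := triangle_free edf efa.
have efb := triangle_free efa eab.
have eS := (eirr, eab, ebc, ecd, edf, efa, eac, ebd, ecf, eda, efb).
by case: i => [|[|[|[|[|i]]]]] // _; case: j => [|[|[|[|[|j]]]]] // _ /=;
   rewrite ?eS // esym eS.
Qed.

(* Indices of the consecutive vertices of an induced path of [c]. *)
Definition arc (l : seq nat) :=
  [&& uniq l, all (ltn^~ 5) l
    & all (fun i => all (fun j => (i < j) ==>
        (adj5 (nth 0 l i) (nth 0 l j) == (j == i.+1))) (iota 0 (size l)))
        (iota 0 (size l))].

Lemma arcP l : arc l ->
  [/\ uniq l, forall j, j < size l -> nth 0 l j < 5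
    & forall i j, i < j < size l -> adj5 (nth 0 l i) (nth 0 l j) = (j == i.+1)].
Proof.
move=> /and3P[uniq_l /allP l_lt5 /allP adj_l]; split=> // [j lt_j | i j /andP[lt_ij lt_j]].
  exact/l_lt5/mem_nth.
have lt_i := ltn_trans lt_ij lt_j.
have mem_l k : k < size l -> k \in iota 0 (size l) by rewrite mem_iota.
by have /allP/(_ j (mem_l j lt_j)) := adj_l i (mem_l i lt_i); rewrite lt_ij => /eqP.
Qed.

Variables (w : nat -> T) (n : nat).
Hypotheses (ind_w : induced_walk w n) (w_c : forall k, k <= n -> w k \notin c).

(** The hole has [t - s + size l + 1] vertices; if odd, it is a 5-cycle. Were the arc to have an
    edge, this 5-cycle would share it with [c] and so coincide with [c], although it contains [w s].
    An arc of one vertex escapes this argument. *)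
Lemma closing s t (l : seq nat) : arc l -> s < t <= n -> 0 < size l ->
  (forall k j, s <= k <= t -> j < size l ->
     e (w k) (v (nth 0 l j)) = (k == t) && (j == 0) || (k == s) && (j == (size l).-1)) ->
  4 <= t - s + size l /\ (odd (t - s + size l + 1) -> t - s + size l = 4 /\ size l = 1).
Proof.
move=> /arcP[uniq_l l5 adj_l] lt_st l_gt0 cross.
have [_ uniq_c _] := cyc_c.
have mem_l i : i \in l -> i < 5 by move=> il; rewrite -(nth_index 0 il) l5 ?index_mem.
have [|||||c' [ind_c' size_c' sub_q ws]] :=
    @hole_through_walk w n s t x0 (map v l) ind_w lt_st; rewrite ?size_map //.
- rewrite map_inj_in_uniq // => i j /mem_l lt_i /mem_l lt_j /eqP.
  by rewrite nth_uniq ?size_c // => /eqP.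
- move=> i j lt_ij; have /andP[lt_ij' lt_j] := lt_ij.
  have lt_i := ltn_trans lt_ij' lt_j.
  by rewrite !(nth_map 0) // adj5E ?l5 // adj_l.
- move=> k le_k; apply: contra (w_c le_k) => /mapP[i /mem_l lt_i ->].
  by rewrite mem_nth ?size_c.
- by move=> k j le_k lt_j; rewrite (nth_map 0) // cross.
have [] := induced_cycle_even_or_5 ind_c'; rewrite size_c' size_map => ge5 odd5.
split=> [|/odd5 size5]; first by lia.
split; first by lia.
apply/eqP/negPn/negP => l_neq1.
have lt_1 : 1 < size l by lia.
have e01 : e (v (nth 0 l 0)) (v (nth 0 l 1)) by rewrite adj5E ?l5 ?adj_l.
have mem_q j : j < size l -> (v (nth 0 l j) \in c) && (v (nth 0 l j) \in c').
  by move=> lt_j; rewrite mem_nth ?size_c ?l5 // sub_q // map_f // mem_nth.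
have /andP[v0c v0c'] := mem_q 0 l_gt0; have /andP[v1c v1c'] := mem_q 1 lt_1.
have [cyc_c' ind] := ind_c'; have [_ ind0] := pentagon_induced cyc_c size_c.
have {}size5 : size c' = 5 by rewrite size_c' size_map.
(* Both cycles are induced, so the adjacent pair [e01] is an edge of each. *)
have eqE := no_shared_edge cyc_c' size5 cyc_c size_c
  (ind _ _ v0c' v1c' e01) (ind0 _ _ v0c v1c e01).
by have := mem_eq_cycle_edges eqE ws; apply/negP/w_c; lia.
Qed.

Lemma closing_even s t l : arc l -> s < t <= n -> 1 < size l ->
  (forall k j, s <= k <= t -> j < size l ->
     e (w k) (v (nth 0 l j)) = (k == t) && (j == 0) || (k == s) && (j == (size l).-1)) ->
  4 <= t - s + size l /\ odd (t - s + size l).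
Proof. by move=> arc_l lt_st l_gt1 /closing[]//; lia. Qed.

(** * Parities along a walk from colour 1 to colour 4 without colour 0 *)

Hypotheses (w_v0 : forall k, k <= n -> e (w k) (v 0) = false)
  (w_v1 : forall k, k <= n -> e (w k) (v 1) = (k == 0))
  (w_v4 : forall k, k <= n -> e (w k) (v 4) = (k == n)).
Let col2 k := e (w k) (v 2).
Let col3 k := e (w k) (v 3).
Definition none_between (p : pred nat) s t := forall k, s < k < t -> ~~ p k.

Lemma w_one_nbr k i j : k <= n -> i < 5 -> j < 5 -> i != j ->
  e (w k) (v i) -> e (w k) (v j) = false.
Proof.
move=> le_k lt_i lt_j neq_ij; have [_ uniq_c _] := cyc_c.
apply: (one_neighbour_on_pentagon cyc_c); rewrite ?w_c ?mem_nth ?nth_uniq ?size_c //.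
Qed.

Lemma col2_interior k : k <= n -> col2 k -> [/\ 0 < k, k < n & col3 k = false].
Proof.
move=> le_k ak; split; last exact: w_one_nbr ak.
  by rewrite lt0n -w_v1 // (w_one_nbr _ _ _ _ ak).
by rewrite ltn_neqAle le_k -w_v4 // (w_one_nbr _ _ _ _ ak).
Qed.

Lemma col3_interior k : k <= n -> col3 k -> [/\ 0 < k, k < n & col2 k = false].
Proof.
move=> le_k ak; split; last exact: w_one_nbr ak.
  by rewrite lt0n -w_v1 // (w_one_nbr _ _ _ _ ak).
by rewrite ltn_neqAle le_k -w_v4 // (w_one_nbr _ _ _ _ ak).
Qed.

Lemma walk_length_gt0 : 0 < n.
Proof.
have := w_v4 (leq0n n); rewrite lt0n eq_sym => <-.
by rewrite (@w_one_nbr 0 1) // w_v1.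
Qed.

Lemma none_between_ends (p : pred nat) s t k : none_between p s t -> s <= k <= t ->
  k != s -> k != t -> p k = false.
Proof. by move=> nst le_k nks nkt; apply: negbTE; apply: nst; lia. Qed.

(** Arcs are listed from the neighbour of [w t] back to that of [w s], hence [[:: 3; 2]]. The hole
    has [t - s + 3] vertices: evenness gives the parity and the girth gives the bound. *)
Lemma close23 s t : s < t <= n -> col2 s -> col3 t ->
  none_between col2 s t -> none_between col3 s t ->
  odd (t - s) /\ 2 <= t - s.
Proof.
move=> lt_st a2s a3t n2 n3.
have le_sn : s <= n by lia. have le_tn : t <= n by lia.
have [_ _ a3s] := col2_interior le_sn a2s. have [_ _ a2t] := col3_interior le_tn a3t.
have [|] := @closing_even s t [:: 3; 2] isT lt_st isT; last by rewrite /=; lia.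
move=> k [|[|j]] //= le_k _; rewrite ?andbT ?andbF ?orbF.
- have [->//|nkt] := eqVneq k t; have [->//|nks] := eqVneq k s.
  exact: none_between_ends n3 _ nks nkt.
- have [->//|nks] := eqVneq k s; have [->//|nkt] := eqVneq k t.
  exact: none_between_ends n2 _ nks nkt.
Qed.

Lemma close32 s t : s < t <= n -> col3 s -> col2 t ->
  none_between col2 s t -> none_between col3 s t ->
  odd (t - s) /\ 2 <= t - s.
Proof.
move=> lt_st a3s a2t n2 n3.
have le_sn : s <= n by lia. have le_tn : t <= n by lia.
have [_ _ a2s] := col3_interior le_sn a3s. have [_ _ a3t] := col2_interior le_tn a2t.
have [|] := @closing_even s t [:: 2; 3] isT lt_st isT; last by rewrite /=; lia.
move=> k [|[|j]] //= le_k _; rewrite ?andbT ?andbF ?orbF.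
- have [->//|nkt] := eqVneq k t; have [->//|nks] := eqVneq k s.
  exact: none_between_ends n2 _ nks nkt.
- have [->//|nks] := eqVneq k s; have [->//|nkt] := eqVneq k t.
  exact: none_between_ends n3 _ nks nkt.
Qed.

(** The arc is a single vertex, so a 5-cycle remains possible; its [t - s + 2] vertices account for
    the value 3. *)
Lemma close_same i s t : i < 5 -> s < t <= n -> e (w s) (v i) -> e (w t) (v i) ->
  none_between (fun k => e (w k) (v i)) s t -> odd (t - s) -> t - s = 3.
Proof.
move=> lt_i lt_st ais ait ni odd_ts.
have arc_i : arc [:: i] by rewrite /arc /= lt_i.
have [|] := @closing s t [:: i] arc_i lt_st isT; last by rewrite /=; lia.
move=> k [|j] //= le_k _; rewrite ?andbT orbC.
have [->//|nks] := eqVneq k s; have [->//|nkt] := eqVneq k t.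
exact: none_between_ends ni _ nks nkt.
Qed.

(** The return through [v 4] and [v 0] avoids [v 2], so vertices of colour 2 before [t] do no
    harm. *)
Lemma close13 t : t <= n -> col3 t -> (forall k, k < t -> ~~ col3 k) -> odd t.
Proof.
move=> le_tn a3t n3; have [t_gt0 lt_tn _] := col3_interior le_tn a3t.
have [||_] := @closing_even 0 t [:: 3; 4; 0; 1] isT _ isT;
  rewrite ?t_gt0 //=; last by lia.
move=> k [|[|[|[|j]]]] //= le_k _; have le_kn : k <= n by lia.
- rewrite andbT andbF orbF; have [->//|nkt] := eqVneq k t.
  by apply: negbTE; apply: n3; lia.
- by rewrite w_v4 //; lia.
- by rewrite w_v0 //; lia.
- by rewrite w_v1 //; lia.
Qed.

(** Without colour 2 the short return through [v 2] is also induced, and its arc has one vertex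
    fewer than that of [close13]: the parities clash. *)
Lemma close13_no2 t : t <= n -> col3 t -> (forall k, k < t -> ~~ col3 k) ->
  (forall k, k < t -> ~~ col2 k) -> False.
Proof.
move=> le_tn a3t n3 n2; have [t_gt0 lt_tn a2t] := col3_interior le_tn a3t.
have := close13 le_tn a3t n3.
have [||_] := @closing_even 0 t [:: 3; 2; 1] isT _ isT;
  rewrite ?t_gt0 //=; last by lia.
move=> k [|[|[|j]]] //= le_k _; have le_kn : k <= n by lia.
- rewrite andbT andbF orbF; have [->//|nkt] := eqVneq k t.
  by apply: negbTE; apply: n3; lia.
- rewrite !andbF; have [->//|nkt] := eqVneq k t.
  by apply: negbTE; apply: n2; lia.
- by rewrite w_v1 //; lia.
Qed.

(** Mirror image of [close13]; the bound [n.+1] makes [s] the last index of colour 2, with [n]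
    included. *)
Lemma close24 s : s <= n -> col2 s -> none_between col2 s n.+1 -> odd (n - s).
Proof.
move=> le_sn a2s n2; have [s_gt0 lt_sn _] := col2_interior le_sn a2s.
have [||_] := @closing_even s n [:: 4; 0; 1; 2] isT _ isT;
  rewrite ?lt_sn ?leqnn //=; last by lia.
move=> k [|[|[|[|j]]]] //= le_k _; have le_kn : k <= n by lia.
- by rewrite w_v4 //; lia.
- by rewrite w_v0 //; lia.
- by rewrite w_v1 //; lia.
- rewrite andbT andbF; have [->//|nks] := eqVneq k s.
  by apply: negbTE; apply: n2; lia.
Qed.

Lemma close24_no3 s : s <= n -> col2 s ->
  none_between col2 s n.+1 -> none_between col3 s n.+1 -> False.
Proof.
move=> le_sn a2s n2 n3; have [s_gt0 lt_sn a3s] := col2_interior le_sn a2s.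
have := close24 le_sn a2s n2.
have [||_] := @closing_even s n [:: 4; 3; 2] isT _ isT;
  rewrite ?lt_sn ?leqnn //=; last by lia.
move=> k [|[|[|j]]] //= le_k _; have le_kn : k <= n by lia.
- by rewrite w_v4 //; lia.
- rewrite !andbF; have [->//|nks] := eqVneq k s.
  by apply: negbTE; apply: n3; lia.
- rewrite andbT andbF; have [->//|nks] := eqVneq k s.
  by apply: negbTE; apply: n2; lia.
Qed.

Lemma close14 : ~~ odd n.
Proof.
have n0 := walk_length_gt0.
have [||_] := @closing_even 0 n [:: 4; 0; 1] isT _ isT;
  rewrite ?n0 ?leqnn //=; last by lia.
move=> k [|[|[|j]]] //= le_k _.
- by rewrite w_v4 //; lia.
- by rewrite w_v0 //; lia.
- by rewrite w_v1 //; lia.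
Qed.

(** Both arcs from [v 4] to [v 1] are then available, with 3 and 4 vertices, and require opposite
    parities of [n]. *)
Lemma close14_no23 : (forall k, k <= n -> ~~ col2 k) ->
  (forall k, k <= n -> ~~ col3 k) -> False.
Proof.
move=> n2 n3; have n0 := walk_length_gt0; have := close14.
have [||_] := @closing_even 0 n [:: 4; 3; 2; 1] isT _ isT;
  rewrite ?n0 ?leqnn //=; last by lia.
move=> k [|[|[|[|j]]]] //= le_k _; rewrite ?andbF /=.
- by rewrite w_v4 //; lia.
- by apply: negbTE; apply: n3.
- by apply: negbTE; apply: n2.
- by rewrite w_v1 //; lia.
Qed.

(** * Nearest indices of a colour and the parity of colour changes *)

Lemma last_before (p : pred nat) s :
  (exists r, [/\ r < s, p r & none_between p r s]) \/ (forall k, k < s -> ~~ p k).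
Proof.
elim: s => [|s IHs]; first by right.
have [ps | nps] := boolP (p s).
  by left; exists s; split=> // k; lia.
case: IHs => [[r [lt_rs pr nr]] | IHs]; [left; exists r | right].
  split=> // [|k lt_k]; first exact: ltnW.
  by have [->//|nks] := eqVneq k s; apply: nr; lia.
by move=> k lt_k; have [->//|nks] := eqVneq k s; apply: IHs; lia.
Qed.

Lemma first_upto (p : pred nat) t : p t ->
  exists r, [/\ r <= t, p r & forall k, k < r -> ~~ p k].
Proof.
move=> pt; have ex_p : exists k, p k by exists t.
case: (ex_minnP ex_p) => r pr min_r; exists r; split=> // [|k lt_k]; first exact: min_r.
by apply/negP => /min_r; rewrite leqNgt lt_k.
Qed.

Lemma first_after (p : pred nat) s t : s < t -> p t ->
  exists r, [/\ s < r <= t, p r & none_between p s r].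
Proof.
move=> lt_st pt.
have [//=|r [le_rt /andP[lt_sr pr] nr]] := @first_upto (fun k => (s < k) && p k) t.
  by rewrite lt_st.
exists r; split=> // [|k /andP[lt_sk lt_kr]]; first by rewrite lt_sr.
by have := nr k lt_kr; rewrite lt_sk.
Qed.

(* Compare [t] with the previous index of the same colour: closing the walk at
   that vertex of the pentagon makes their distance even or 3, and the two colour
   changes in between make it at least 4. *)
Lemma switch_parity t s : s < t <= n -> none_between col2 s t -> none_between col3 s t ->
  (col2 s -> col3 t -> odd t) /\ (col3 s -> col2 t -> ~~ odd t).
Proof.
elim/ltn_ind: t s => t IHt s lt_st n2 n3.
have le_sn : s <= n by lia. have le_tn : t <= n by lia.
split=> as_ at_.
- have [odd_ts ge2] := close23 lt_st as_ at_ n2 n3.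
  have [_ _ a3s] := col2_interior le_sn as_.
  have n3t r : none_between col3 r s -> none_between col3 r t.
    move=> n3r k lt_k; have [->|nks] := eqVneq k s; first by rewrite a3s.
    by case: (ltnP k s) => le_k; [apply: n3r | apply: n3]; lia.
  (* Without an earlier colour 3, [t] is its first index and [close13] applies. *)
  have [[r [lt_rs col3r n3r]] | n3s] := last_before col3 s; last first.
    apply: close13 => // k lt_k; have [->|nks] := eqVneq k s; first by rewrite a3s.
    by case: (ltnP k s) => le_k; [apply: n3s | apply: n3; lia].
  have [r' [lt_r' a2r' n2r']] := first_after lt_rs as_.
  have n3r' : none_between col3 r r' by move=> k lt_k; apply: n3r; lia.
  have lt_rn : r < r' <= n by lia.
  have [odd_r ge2r] := close32 lt_rn col3r a2r' n2r' n3r'.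
  have lt_r't : r' < t by lia.
  (* The change from [r] to [r'] has odd length, so the parity of [r'] gives that of [r], and [t]
     agrees with [r]. *)
  have [_ /(_ col3r a2r') even_r'] := IHt r' lt_r't r lt_rn n2r' n3r'.
  have lt_rtn : r < t <= n by lia.
  have := close_same _ lt_rtn col3r at_ (n3t r n3r); move/(_ isT).
  by lia.
- have [odd_ts ge2] := close32 lt_st as_ at_ n2 n3.
  have [_ _ a2s] := col3_interior le_sn as_.
  have n2t r : none_between col2 r s -> none_between col2 r t.
    move=> n2r k lt_k; have [->|nks] := eqVneq k s; first by rewrite a2s.
    by case: (ltnP k s) => le_k; [apply: n2r | apply: n2]; lia.
  (* Without an earlier colour 2, the first colour 3 contradicts [close13_no2]. *)
  have [[r [lt_rs a2r n2r]] | n2s] := last_before col2 s; last first.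
    have [r [le_rs col3r n3r]] := first_upto as_.
    have le_rn : r <= n by lia.
    by case: (close13_no2 le_rn col3r n3r) => k lt_k; apply: n2s; lia.
  have [r' [lt_r' col3r' n3r']] := first_after lt_rs as_.
  have n2r' : none_between col2 r r' by move=> k lt_k; apply: n2r; lia.
  have lt_rn : r < r' <= n by lia.
  have [odd_r ge2r] := close23 lt_rn a2r col3r' n2r' n3r'.
  have lt_r't : r' < t by lia.
  have [/(_ a2r col3r') odd_r' _] := IHt r' lt_r't r lt_rn n2r' n3r'.
  have lt_rtn : r < t <= n by lia.
  have := close_same _ lt_rtn a2r at_ (n2t r n2r); move/(_ isT).
  by lia.
Qed.

(** [n] is even, so the last index [j] of colour 2 is odd. The first colour 3 after [j] lies at odd
    distance from it, hence at an even index, against [switch_parity]. The closing lemmas exclude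
    the cases where such indices are missing. *)
Lemma no_induced_walk : False.
Proof.
have even_n := close14.
have [[j [lt_jn col2j n2j]] | n2] := last_before col2 n.+1; last first.
  have [[t [lt_tn a3t _]] | n3] := last_before col3 n.+1; last exact: close14_no23.
  have [r [le_rt col3r n3r]] := first_upto a3t.
  have le_rn : r <= n by lia.
  by case: (close13_no2 le_rn col3r n3r) => k lt_k; apply: n2; lia.
have odd_nj := close24 lt_jn col2j n2j.
have [/hasP[t] | no3] := boolP (has col3 (iota j.+1 (n - j))).
  rewrite mem_iota => lt_t a3t; have lt_jt : j < t by lia.
  have [r [lt_r col3r n3r]] := first_after lt_jt a3t.
  have lt_jr : j < r <= n by lia.
  have n2r : none_between col2 j r by move=> k lt_k; apply: n2j; lia.
  have [odd_rj _] := close23 lt_jr col2j col3r n2r n3r.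
  by have [/(_ col2j col3r)] := switch_parity lt_jr n2r n3r; lia.
apply: (close24_no3 lt_jn col2j n2j) => k lt_k.
by apply: (hasPn no3); rewrite mem_iota; lia.
Qed.

End OnePentagon.

(** * From walks to connectivity *)

Lemma induced_rel_connect_sym (A : pred T) : connect_sym (induced_rel A).
Proof. by apply: sym_connect_sym => x y; rewrite /induced_rel /= esym andbCA. Qed.

Lemma no_walk_avoiding v0 v1 v2 v3 v4 x y :
  let c := [:: v0; v1; v2; v3; v4] in
  let A := fun z => (z \notin c) && ~~ e z v0 in
  is_cycle e c -> A x -> e x v1 -> e y v4 -> ~ connect (induced_rel A) x y.
Proof.
move=> c A cyc_c Ax exv1 eyv4 conn_xy.
have [w [n [ind_w Aw w1 w4]]] := @exists_induced_walk A
  (fun z => e z v1) (fun z => e z v4) x y esym eirr Ax exv1 eyv4 conn_xy.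
apply: (no_induced_walk (x0 := v0) cyc_c erefl ind_w) => // k /Aw/andP[] //.
by move=> _ /negbTE.
Qed.

(** Turns a component into one walk visiting all of it, whose prefixes can then be compared;
    symmetry lets the walk go back through [x]. *)
Lemma walk_through (r : rel T) x (l : seq T) : connect_sym r ->
  (forall y, y \in l -> connect r x y) ->
  exists2 p, path r x p & {subset l <= x :: p}.
Proof.
move=> symr; elim: l => [|y l IHl] conn_l; first by exists [::].
have [z zl | p path_p sub_l] := IHl; first by rewrite conn_l // inE zl orbT.
have : connect r (last x p) y.
  apply: connect_trans (conn_l y (mem_head _ _)); rewrite symr.
  by apply/connectP; exists p.
case/connectP=> q path_q def_y; exists (p ++ q); first by rewrite cat_path path_p.
move=> z; rewrite inE => /orP[/eqP-> | /sub_l].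
  by rewrite def_y -last_cat mem_last.
by rewrite -cat_cons mem_cat => ->.
Qed.

(** * Pentagon vertices seen from one component *)

Section OnePentagon.
Variable c : seq T.
Hypotheses (cyc_c : is_cycle e c) (size_c : size c = 5).

Definition sees (s : seq T) (v : T) := has (fun y => e y v) s.

Lemma count_sees_rcons s y : y \notin c ->
  count (sees (rcons s y)) c <= (count (sees s) c).+1.
Proof.
move=> yc; have [_ uniq_c _] := cyc_c.
have le1 : count (e y) c <= 1.
  rewrite -size_filter leqNgt; apply/negP => size_f.
  have mem_f v : v \in filter (e y) c -> e y v /\ v \in c by rewrite mem_filter => /andP.
  have := filter_uniq (e y) uniq_c.
  case: (filter _ _) size_f mem_f => [|u [|v f]] // _ mem_f /=.
  case/andP; rewrite inE negb_or => /andP[nuv _] _.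
  have [eyu uc] := mem_f u (mem_head _ _).
  have [|eyv vc] := mem_f v; first by rewrite !inE eqxx orbT.
  by rewrite (one_neighbour_on_pentagon cyc_c size_c yc uc vc) in eyv.
rewrite -addn1; apply: leq_trans (leq_add (leqnn _) le1).
rewrite -count_predUI; apply: leq_trans (leq_addr _ _).
by apply: sub_count => v; rewrite /sees has_rcons /= orbC.
Qed.

(** Discrete intermediate values: each further vertex raises the count by at most one. *)
Lemma prefix_seeing k s : all (fun y => y \notin c) s -> k <= count (sees s) c ->
  exists s1 s2, s = s1 ++ s2 /\ count (sees s1) c = k.
Proof.
elim/last_ind: s => [|s y IHs].
  move=> _ le_k; exists [::], [::]; split=> //; apply/eqP; rewrite eqn_leq le_k andbT.
  by rewrite (eq_count (a2 := pred0)) ?count_pred0.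
rewrite all_rcons => /andP[yc s_c] le_k.
have [le_ks | lt_sk] := leqP k (count (sees s) c).
  have [s1 [s2 [-> count_s1]]] := IHs s_c le_ks.
  by exists s1, (rcons s2 y); rewrite rcons_cat.
exists (rcons s y), [::]; rewrite cats0; split=> //.
by have := count_sees_rcons s yc; lia.
Qed.

Lemma no_connected_sees_4 x p :
  path (induced_rel (fun y => y \notin c)) x p -> x \notin c ->
  count (sees (x :: p)) c < 4.
Proof.
set r := induced_rel _ => path_p xc; rewrite ltnNge; apply/negP => count4.
have p_c : all (fun y => y \notin c) (x :: p).
  rewrite /= xc; elim: p {count4} x path_p {xc} => //= y p IHp x.
  by case/andP=> /and3P[_ -> _] /IHp.
have [s1 [s2 []]] := prefix_seeing p_c count4.
case: s1 => [|x' p1] /=; first by rewrite (eq_count (a2 := pred0)) ?count_pred0.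
case=> <- def_p count_s1; rewrite {}def_p /= in path_p p_c.
move: path_p p_c; rewrite cat_path all_cat => /andP[path_p1 _] /and3P[_ p1_c _].
have [_ uniq_c _] := cyc_c.
have /hasP[z zc nz] : has (predC (sees (x :: p1))) c.
  by rewrite has_count; have := count_predC (sees (x :: p1)) c; lia.
(* Exactly four are seen, so [z] is the only one missed and both its neighbours on [c] are seen. *)
have size_f : size (filter (predC (sees (x :: p1))) c) = 1.
  by rewrite size_filter; have := count_predC (sees (x :: p1)) c; lia.
have seen u : u \in c -> u != z -> exists2 y, y \in x :: p1 & e y u.
  move=> uc nuz; apply/hasP/negPn; apply: contra nuz => nu.
  have : z \in filter (predC (sees (x :: p1))) c by rewrite mem_filter nz.
  have : u \in filter (predC (sees (x :: p1))) c by rewrite mem_filter /= nu.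
  by case: (filter _ _) size_f => [|v []] // _; rewrite !inE => /eqP-> /eqP->.
have [v1 [v2 [v3 [v4 [cyc_c' mem_c']]]]] := pentagon_rot cyc_c size_c zc.
have [_ /= uniq_c' _] := cyc_c'.
have [y1 y1s ey1] : exists2 y, y \in x :: p1 & e y v1.
  apply: seen; first by rewrite mem_c' !inE eqxx orbT.
  by apply: contraTneq uniq_c' => ->; rewrite !inE eqxx.
have [y4 y4s ey4] : exists2 y, y \in x :: p1 & e y v4.
  apply: seen; first by rewrite mem_c' !inE eqxx !orbT.
  by apply: contraTneq uniq_c' => ->; rewrite !inE eqxx !orbT.
pose A u := (u \notin [:: z; v1; v2; v3; v4]) && ~~ e u z.
have all_A : all A (x :: p1).
  apply/allP=> u us; rewrite /A -mem_c'; apply/andP; split.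
    by move: us; rewrite inE => /orP[/eqP-> // | /(allP p1_c)].
  by apply: contra nz => euz; apply/hasP; exists u.
have conn u : u \in x :: p1 -> connect (induced_rel A) x u.
  apply: path_connect; apply: sub_in_path all_A path_p1.
  by move=> u1 u2 Au1 Au2 /and3P[_ _ eu]; apply/and3P; split.
apply: (@no_walk_avoiding z v1 v2 v3 v4 y1 y4 cyc_c') => //; first exact: (allP all_A).
by apply: connect_trans (conn _ y4s); rewrite induced_rel_connect_sym conn.
Qed.

(** * Attachments and 3-cutsets *)

Hypothesis stable_cutsets : forall S : {set T}, is_cutset e 3 S -> stable e S.

Lemma rem2_pentagon_edge u v : u \in c -> v \in c -> u != v ->
  exists a b, [/\ a \in rem u (rem v c), b \in rem u (rem v c) & e a b].
Proof.
move=> uc vc nuv; have [_ uniq_c _] := cyc_c.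
have mem_r z : (z \in rem u (rem v c)) = [&& z != u, z != v & z \in c].
  by rewrite mem_rem_uniq ?rem_uniq // inE (mem_rem_uniq _ uniq_c) inE.
have [v1 [v2 [v3 [v4 [cyc_c' mem_c']]]]] := pentagon_rot cyc_c size_c uc.
have [_ uniq_c' _] := cyc_c'; have [/= /and5P[e01 e12 e23 e34 _] _ _] := cyc_c'.
(* Each distinctness is read off a decomposition of the list, verified by [erefl]. *)
have neq x y s1 s2 s3 : [:: u; v1; v2; v3; v4] = s1 ++ x :: s2 ++ y :: s3 -> y != x.
  move=> def_s; apply: contraTneq uniq_c' => eq_yx.
  by rewrite def_s eq_yx cat_uniq /= mem_cat mem_head orbT /= !andbF.
have n1 : v1 != u := neq _ _ [::] [::] _ erefl.
have n2 : v2 != u := neq _ _ [::] [:: _] _ erefl.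
have n3 : v3 != u := neq _ _ [::] [:: _; _] _ erefl.
have n4 : v4 != u := neq _ _ [::] [:: _; _; _] _ erefl.
have n12 : v2 != v1 := neq _ _ [:: _] [::] _ erefl.
have n13 : v3 != v1 := neq _ _ [:: _] [:: _] _ erefl.
have n14 : v4 != v1 := neq _ _ [:: _] [:: _; _] _ erefl.
have n23 : v3 != v2 := neq _ _ [:: _; _] [::] _ erefl.
have n24 : v4 != v2 := neq _ _ [:: _; _] [:: _] _ erefl.
have n34 : v4 != v3 := neq _ _ [:: _; _; _] [::] _ erefl.
have : v \in [:: u; v1; v2; v3; v4] by rewrite -mem_c'.
rewrite inE eq_sym (negbTE nuv) !inE /= => /or4P[] /eqP def_v.
- by exists v2, v3; rewrite !mem_r !mem_c' def_v !inE !eqxx !orbT n2 n3 n12 n13.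
- by exists v3, v4; rewrite !mem_r !mem_c' def_v !inE !eqxx !orbT n3 n4 n23 n24.
- exists v1, v2; rewrite !mem_r !mem_c' def_v !inE !eqxx !orbT n1 n2.
  by rewrite (eq_sym v1) (eq_sym v2) n13 n23.
- exists v1, v2; rewrite !mem_r !mem_c' def_v !inE !eqxx !orbT n1 n2.
  by rewrite (eq_sym v1) (eq_sym v2) n14 n24.
Qed.

(** Otherwise the three other vertices of [c] separate [x] from [u], and they contain an edge. *)
Lemma component_attachments x u v : x \notin c -> u \in c -> v \in c -> u != v ->
  exists2 y, connect (induced_rel (fun y => y \notin c)) x y & e y u || e y v.
Proof.
set r := induced_rel _ => xc uc vc nuv; apply: NNPP => no_y.
have [_ uniq_c _] := cyc_c; pose S := [set z in rem u (rem v c)].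
have memS z : (z \in S) = [&& z != u, z != v & z \in c].
  by rewrite inE mem_rem_uniq ?rem_uniq // inE (mem_rem_uniq _ uniq_c) inE.
have [a [b [aS bS eab]]] := rem2_pentagon_edge uc vc nuv.
suff /stable_cutsets/(_ a b) : is_cutset e 3 S by rewrite !inE aS bS eab => /(_ isT isT).
split.
  rewrite cardsE; have /card_uniqP-> : uniq (rem u (rem v c)) by rewrite !rem_uniq.
  by rewrite !size_rem ?size_c // mem_rem_uniq // !inE nuv.
exists x, u; rewrite !memS eqxx (negbTE xc) !andbF; split=> //.
apply/negP => /connectP[p path_p last_p].
suff /andP[_] : connect r x (last x p) && (last x p \notin c) by rewrite -last_p uc.
(* A path from [x] avoiding [S] could enter [c] only at [u] or [v], which the component does not
   touch. *)
elim/last_ind: p {last_p} path_p => [|p z IHp]; first by rewrite /= connect0 xc.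
rewrite rcons_path last_rcons => /andP[/IHp/andP[conn_y yc] /and3P[_ zS eyz]].
have zc : z \notin c.
  apply/negP => zc; apply: no_y; exists (last x p) => //.
  move: zS; rewrite memS zc andbT negb_and !negbK => /orP[/eqP <- | /eqP <-];
  by rewrite eyz ?orbT.
rewrite zc andbT; apply: connect_trans conn_y _; apply: connect1.
exact/and3P.
Qed.

Lemma pentagon_spanning x : x \in c.
Proof.
apply/negPn/negP => xc; set r := induced_rel (fun y => y \notin c).
have [_ uniq_c _] := cyc_c.
pose attached v := [exists y, connect r x y && e y v].
have [z att] : exists z, {in c, forall v, v != z -> attached v}.
  have [all_att | /allPn[z zc natt]] := boolP (all attached c).
    (* Any vertex outside [c] serves here, since nothing needs to be excepted. *)
    by exists x => v /(allP all_att).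
  exists z => v vc nvz; apply: contraNT natt => natt_v.
  have [y conn_y] := component_attachments xc vc zc nvz.
  case/orP=> ey; last by apply/existsP; exists y; rewrite conn_y.
  by case/negP: natt_v; apply/existsP; exists y; rewrite conn_y.
have [y | p path_p sub_p] :=
  @walk_through r x (enum (connect r x)) (induced_rel_connect_sym _).
  by rewrite mem_enum.
have := no_connected_sees_4 path_p xc; rewrite ltnNge => /negP[].
have count_z : count (predC (pred1 z)) c >= 4.
  have := count_predC (pred1 z) c; rewrite size_c count_uniq_mem //.
  by case: (z \in c) => /=; lia.
apply: leq_trans count_z _; rewrite -!size_filter.
apply: uniq_leq_size; first exact: filter_uniq.
move=> v; rewrite !mem_filter => /andP[nvz vc]; rewrite vc andbT.
have /existsP[y /andP[conn_y eyv]] := att v vc nvz.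
by apply/hasP; exists y => //; apply: sub_p; rewrite mem_enum.
Qed.

(** If [c] were the whole graph, deleting the two neighbours of [v0] would isolate it, since [c] has
    no chord. *)
Lemma pentagon_not_spanning : k_connected e 3 -> exists x, x \notin c.
Proof.
move=> [_ conn3]; apply: NNPP => all_c.
have memc x : x \in c by apply/negPn/negP => xc; apply: all_c; exists x.
case: c size_c cyc_c memc => [|v0 [|v1 [|v2 [|v3 [|v4 []]]]]] // _ cyc memc.
have [/= /and5P[e01 e12 e23 e34 /andP[e40 _]] uniq_c _] := cyc.
have e02 := triangle_free e01 e12.
have e30 := triangle_free e34 e40.
apply: (conn3 [set v1; v4]); first by rewrite cards2; case: (_ == _).
move: uniq_c; rewrite /= !inE !negb_or -!andbA.
case/and5P=> n01 n02 n03 n04 /and5P[n12 n13 n14 n23 /and3P[n24 _ _]].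
exists v0, v2; rewrite !inE !negb_or n01 n04 (eq_sym v2) n12 n24; split=> //.
apply/negP => /connectP[[|z p] /=]; first by move=> _ eq_v; rewrite eq_v eqxx in n02.
case/andP=> /and3P[_]; rewrite !inE negb_or => /andP[nz1 nz4] e0z _ _.
move: (memc z); rewrite !inE (negbTE nz1) (negbTE nz4) /= orbF.
by case/or3P=> /eqP def_z; move: e0z; rewrite def_z ?eirr ?e02 // esym e30.
Qed.

End OnePentagon.
End NoSharedEdge.
End Girth5.
End Graph.

Theorem theorem1p5 (T : finType) (e : rel T)
  (simple_e : is_simple_graph e)
  (conn_e : k_connected e 3)
  (G2_e : in_G2 e)
  (has_C5 : exists c : seq T, is_cycle e c /\ size c = 5)
  (stable_cutsets : forall S : {set T}, is_cutset e 3 S -> stable e S) :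
  exists c1 c2 : seq T,
    [/\ is_cycle e c1 /\ size c1 = 5,
        is_cycle e c2 /\ size c2 = 5,
        cycle_edges c1 <> cycle_edges c2 &
        exists E : {set T}, E \in cycle_edges c1 /\ E \in cycle_edges c2].
Proof.
case: simple_e G2_e has_C5 => esym eirr [[_ girth5] no_odd_hole] [c [cyc_c size_c]].
apply: NNPP => no_pair.
have [x /negP[]] := pentagon_not_spanning esym eirr girth5 cyc_c size_c conn_e.
apply: (pentagon_spanning esym eirr girth5 no_odd_hole) => // c1 c2 E cyc1 s1 cyc2 s2 E1 E2.
(* The remaining goal is the edge-disjointness assumption: a violation is precisely a pair excluded
   by [no_pair]. *)
by apply: NNPP => neq_E; apply: no_pair; exists c1, c2; split=> //; exists E.
Qed.
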